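(* In a monoidal setting for dynamic stability, assume that the unit clock $1_T\colon T\to\mathcal FT$ is itself $T$-complete. (1) Given a $T$-complete system $f_X\colon X\to\mathcal FX$, $\int f_X$ is a solution to $f_X$. Moreover, the integral defines a functor $\int\colon T\text{-}\mathsf{Sys}_{\mathcal F}\to T\text{-}\mathsf{Flow}$, $(X,f_X)\mapsto(X,\int f_X)$, with the action on morphisms defined trivially (a morphism of systems $p\colon X\to Y$ is sent to the same morphism $p$ of $\mathcal C$). (2) If $\mathrm D\phi$ is $T$-complete for all $T$-flows $\phi$, then for any solution flow $\phi$ of a system $f_X\colon X\to\mathcal FX$ one has $\phi=\int f_X$. Moreover, the derivative defines a functor $\mathrm D\colon T\text{-}\mathsf{Flow}\to T\text{-}\mathsf{Sys}_{\mathcal F}$ satisfying $$\phi=\textstyle\int\mathrm D\phi,\qquad f_X=\mathrm D\int f_X$$ for all $T$-flows $\phi$ and all $T$-complete systems $f_X$. Therefore $\int$ is an isomorphism of categories with inverse $\mathrm D$.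
   Context: Conventions. $\mathcal C$ is a category with all finite products and terminal object $1$; $!\colon X\to 1$ is the unique map; $\langle a,b\rangle$ denotes pairing; $\pi$ denotes a product projection. $\mathcal F\colon\mathcal C\to\mathcal C$ is an endofunctor. An $\mathcal F$-system is a morphism $f\colon X\to\mathcal FX$; a morphism of $\mathcal F$-systems from $f\colon X\to\mathcal FX$ to $g\colon Y\to\mathcal FY$ is $p\colon X\to Y$ with $\mathcal Fp\circ f=g\circ p$; these form the category $\mathsf{Sys}_{\mathcal F}$. An object $R$ is posetal if every hom-set $\mathcal C(A,R)$ carries a partial order $\le$ such that precomposition with any $A'\to A$ is order-preserving. Monoidal setting for dynamic stability. It consists of: an object $E$; a monoid object $(T,\oplus,0_\oplus)$; a posetal object $R$ with a point $o_R\colon 1\to R$; a morphism $d\colon E\times E\to R$ with $d\ge o_R\circ !$ and such that the diagonal $\Delta\colon E\to E\times E$ is the equalizer of $d$ and $o_R\circ !$; an $\mathcal F$-system $1_T\colon T\to\mathcal FT$ (unit clock); a posetal structure on $\mathcal FR$; a natural transformation $\psi_{A,B}\colon\mathcal FA\times\mathcal FB\to\mathcal F(A\times B)$ that is associative, i.e. $\mathcal F\alpha_{X,Y,Z}\circ\psi_{X\times Y,Z}\circ(\psi_{X,Y}\times\mathrm{id})=\psi_{X,Y\times Z}\circ(\mathrm{id}\times\psi_{Y,Z})\circ\alpha_{\mathcal FX,\mathcal FY,\mathcal FZ}$ with $\alpha$ the associativity isomorphism of products; a natural transformation $0_A\colon A\to\mathcal FA$ (stationary systems) with $\psi_{A,B}\circ(0_A\times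 0_B)=0_{A\times B}$; the stable system on $R$ is $\sigma=0_R\colon R\to\mathcal FR$. For an object $X$ put $\mathcal L_X:=\psi_{T,X}\circ(1_T\times 0_X)\colon T\times X\to\mathcal F(T\times X)$. These are subject to the comparison axioms: (D4) for every $\gamma\colon T\to R$, $\mathcal F\gamma\circ 1_T\le\sigma\circ\gamma$ implies $\gamma\le\gamma\circ 0_\oplus\circ !$; (D4') for every object $A$ and every $\gamma\colon T\times A\to R$, $\mathcal F\gamma\circ\mathcal L_A\le 0_R\circ\gamma$ implies $\gamma\le\gamma\circ\langle 0_\oplus\circ !,\mathrm{id}_A\rangle\circ\pi_A$. $T$-completeness. A system $f_A\colon A\to\mathcal FA$ is $T$-complete if for every object $B$ and every $g\colon B\to A$ there is a unique morphism of systems $\gamma\colon(T\times B,\mathcal L_B)\to(A,f_A)$ with $\gamma\circ\langle 0_\oplus\circ !,\mathrm{id}_B\rangle=g$. $T\text{-}\mathsf{Sys}_{\mathcal F}$ is the full subcategory of $\mathsf{Sys}_{\mathcal F}$ on $T$-complete systems. When $1_T$ is $T$-complete, there is a unique monoid structure on $T$ with unit $0_\oplus$ whose multiplication $T\times T\to T$ is a morphism of systems $\mathcal L_T\to 1_T$; the multiplication $\oplus$ is understood to be this one. Flows. A $T$-flow on an object $X$ is a monoid action $\phi\colon T\times X\to X$: $\phi\circ\langle 0_\oplus\circ !,\mathrm{id}_X\rangle=\mathrm{id}_X$ and $\phi\circ(\oplus\times\mathrm{id}_X)=\phi\circ(\mathrm{id}_T\times\phi)$. A morphism of $T$-flows $\phi_X\to\phi_Y$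 is $p\colon X\to Y$ with $p\circ\phi_X=\phi_Y\circ(\mathrm{id}_T\times p)$; this gives the category $T\text{-}\mathsf{Flow}$. A solution to a system $f_X\colon X\to\mathcal FX$ is a morphism of systems $\mathcal L_A\to f_X$ for some object $A$; a solution flow is a solution $\phi\colon T\times X\to X$ (with $A=X$) that is a $T$-flow. Derivative and integral. For a $T$-flow $\phi$ on $X$, $\mathrm D\phi:=\mathcal F\phi\circ\mathcal L_X\circ\langle 0_\oplus\circ !,\mathrm{id}_X\rangle\colon X\to\mathcal FX$; on morphisms $\mathrm D$ acts as the identity on underlying morphisms of $\mathcal C$. For a $T$-complete $f_X\colon X\to\mathcal FX$, $\int f_X\colon T\times X\to X$ is the unique morphism of systems $\mathcal L_X\to f_X$ with $\int f_X\circ\langle 0_\oplus\circ !,\mathrm{id}_X\rangle=\mathrm{id}_X$. *)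

(* Defs.v *)
From Stdlib Require Import Classical ClassicalEpsilon.

Set Implicit Arguments.
Unset Strict Implicit.
Unset Printing Implicit Defensive.

Declare Scope cat_scope.
Delimit Scope cat_scope with cat.
Local Open Scope cat_scope.

Record Category := {
  Ob :> Type;
  Hom : Ob -> Ob -> Type;
  idm : forall A, Hom A A;
  comp : forall A B D, Hom B D -> Hom A B -> Hom A D;
  comp_idl : forall A B (f : Hom A B), comp (idm B) f = f;
  comp_idr : forall A B (f : Hom A B), comp f (idm A) = f;
  comp_assoc : forall A B D E (h : Hom D E) (g : Hom B D) (f : Hom A B),
    comp h (comp g f) = comp (comp h g) f
}.
Arguments Hom {c} A B.
Arguments idm {c} A.

Notation "g ∘ f" := (comp g f) (at level 40, left associativity) : cat_scope.

Record Functor (C D : Category) := {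
  fob :> C -> D;
  fmap : forall A B : C, Hom A B -> Hom (fob A) (fob B);
  fmap_id : forall A : C, fmap (idm A) = idm (fob A);
  fmap_comp : forall (A B E : C) (g : Hom B E) (f : Hom A B),
    fmap (g ∘ f) = fmap g ∘ fmap f
}.
Arguments fmap {C D} _ {A B} _.

Definition functor_id (C : Category) : Functor C C :=
  {| fob := fun A => A;
     fmap := fun A B f => f;
     fmap_id := fun A => eq_refl;
     fmap_comp := fun A B E g f => eq_refl |}.

Definition functor_comp (C D E : Category) (G : Functor D E) (F : Functor C D) :
  Functor C E.
Proof.
refine {| fob := fun A => G (F A); fmap := fun A B f => fmap G (fmap F f) |}.
- intros A; rewrite !fmap_id; reflexivity.
- intros A B X g f; rewrite !fmap_comp; reflexivity.
Defined.

(* Strict equality of functors: an isomorphism of categories, not merely an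
   equivalence. *)
Definition inverse_functors (C D : Category) (F : Functor C D) (G : Functor D C) :
  Prop :=
  functor_comp G F = functor_id C /\ functor_comp F G = functor_id D.

Definition full_subcategory (C : Category) (P : C -> Prop) : Category :=
  {| Ob := {A : C | P A};
     Hom := fun A B => Hom (proj1_sig A) (proj1_sig B);
     idm := fun A => idm (proj1_sig A);
     comp := fun A B D g f => g ∘ f;
     comp_idl := fun A B f => comp_idl f;
     comp_idr := fun A B f => comp_idr f;
     comp_assoc := fun A B D E h g f => comp_assoc h g f |}.

Record CartesianCategory := {
  ccat :> Category;
  one : ccat;
  bang : forall A : ccat, Hom A one;
  bang_uniq : forall (A : ccat) (f : Hom A one), f = bang A;
  prod_ob : ccat -> ccat -> ccat;
  pi1 : forall A B : ccat, Hom (prod_ob A B) A;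
  pi2 : forall A B : ccat, Hom (prod_ob A B) B;
  pair_mor : forall X A B : ccat, Hom X A -> Hom X B -> Hom X (prod_ob A B);
  pi1_pair : forall (X A B : ccat) (f : Hom X A) (g : Hom X B),
    pi1 A B ∘ pair_mor f g = f;
  pi2_pair : forall (X A B : ccat) (f : Hom X A) (g : Hom X B),
    pi2 A B ∘ pair_mor f g = g;
  pair_uniq : forall (X A B : ccat) (h : Hom X (prod_ob A B)),
    h = pair_mor (pi1 A B ∘ h) (pi2 A B ∘ h)
}.
Arguments one {c}.
Arguments bang {c} A.
Arguments pi1 {c} A B.
Arguments pi2 {c} A B.

Notation "A × B" := (prod_ob A B) (at level 40, left associativity) : cat_scope.
Notation "⟨ f , g ⟩" := (pair_mor f g) (at level 0) : cat_scope.

Definition prod_mor (C : CartesianCategory) (A A' B B' : C)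
  (f : Hom A A') (g : Hom B B') : Hom (A × B) (A' × B') :=
  ⟨ f ∘ pi1 A B , g ∘ pi2 A B ⟩.

Notation "f ⊗ g" := (prod_mor f g) (at level 38, left associativity) : cat_scope.

Definition diag (C : CartesianCategory) (A : C) : Hom A (A × A) :=
  ⟨ idm A , idm A ⟩.

Definition prod_assoc (C : CartesianCategory) (A B D : C) :
  Hom ((A × B) × D) (A × (B × D)) :=
  ⟨ pi1 A B ∘ pi1 (A × B) D , ⟨ pi2 A B ∘ pi1 (A × B) D , pi2 (A × B) D ⟩ ⟩.

Definition is_equalizer (C : Category) (K X Y : C)
  (k : Hom K X) (f g : Hom X Y) : Prop :=
  f ∘ k = g ∘ k /\
  forall (A : C) (h : Hom A X), f ∘ h = g ∘ h -> exists! u : Hom A K, k ∘ u = h.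

Record Posetal (C : Category) (R : C) := {
  ple : forall A : C, Hom A R -> Hom A R -> Prop;
  ple_refl : forall (A : C) (f : Hom A R), ple f f;
  ple_antisym : forall (A : C) (f g : Hom A R), ple f g -> ple g f -> f = g;
  ple_trans : forall (A : C) (f g h : Hom A R), ple f g -> ple g h -> ple f h;
  ple_precomp : forall (A A' : C) (h : Hom A' A) (f g : Hom A R),
    ple f g -> ple (f ∘ h) (g ∘ h)
}.

Record MonoidObject (C : CartesianCategory) := {
  mcar :> C;
  mmul : Hom (mcar × mcar) mcar;
  munit : Hom one mcar;
  mmulA : mmul ∘ (mmul ⊗ idm mcar) =
          mmul ∘ (idm mcar ⊗ mmul) ∘ prod_assoc mcar mcar mcar;
  mul_unitl : mmul ∘ ⟨ munit ∘ bang mcar , idm mcar ⟩ = idm mcar;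
  mul_unitr : mmul ∘ ⟨ idm mcar , munit ∘ bang mcar ⟩ = idm mcar
}.

Definition at_zero (C : CartesianCategory) (T : MonoidObject C) (X : C) :
  Hom X (T × X) :=
  ⟨ munit T ∘ bang X , idm X ⟩.

Record System (C : Category) (F : Functor C C) := {
  scar :> C;
  sstr : Hom scar (F scar)
}.

Definition is_system_morphism (C : Category) (F : Functor C C) (S S' : System F)
  (p : Hom S S') : Prop :=
  fmap F p ∘ sstr S = sstr S' ∘ p.

Lemma system_morphism_id (C : Category) (F : Functor C C) (S : System F) :
  is_system_morphism (S := S) (S' := S) (idm S).
Proof.
unfold is_system_morphism; rewrite fmap_id, comp_idl, comp_idr; reflexivity.
Qed.

Lemma system_morphism_comp (C : Category) (F : Functor C C) (S S' S'' : System F)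
  (q : Hom S' S'') (p : Hom S S') :
  is_system_morphism q -> is_system_morphism p -> is_system_morphism (q ∘ p).
Proof.
unfold is_system_morphism; intros Hq Hp.
rewrite fmap_comp, <- comp_assoc, Hp, comp_assoc, Hq, comp_assoc; reflexivity.
Qed.

Lemma sig_ext (A : Type) (P : A -> Prop) (u v : {x : A | P x}) :
  proj1_sig u = proj1_sig v -> u = v.
Proof. apply eq_sig_hprop; intros x p q; apply proof_irrelevance. Qed.

Definition Sys (C : Category) (F : Functor C C) : Category.
Proof.
refine {| Ob := System F;
          Hom := fun S S' => {p : Hom S S' | is_system_morphism p};
          idm := fun S => exist _ (idm (scar S)) (system_morphism_id S);
          comp := fun S S' S'' q p =>
            exist _ (proj1_sig q ∘ proj1_sig p)
              (system_morphism_comp (proj2_sig q) (proj2_sig p)) |}.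
- intros; apply sig_ext; apply comp_idl.
- intros; apply sig_ext; apply comp_idr.
- intros; apply sig_ext; apply comp_assoc.
Defined.

(* In the action law (T × T) × X and T × (T × X) are identified by the
   associativity isomorphism. *)
Definition is_flow (C : CartesianCategory) (T : MonoidObject C) (X : C)
  (phi : Hom (T × X) X) : Prop :=
  phi ∘ at_zero T X = idm X /\
  phi ∘ (mmul T ⊗ idm X) = phi ∘ (idm T ⊗ phi) ∘ prod_assoc T T X.

Record Flow (C : CartesianCategory) (T : MonoidObject C) := {
  flcar :> C;
  flact : Hom (T × flcar) flcar;
  flact_flow : is_flow flact
}.

Definition is_flow_morphism (C : CartesianCategory) (T : MonoidObject C) (X Y : C)
  (phi : Hom (T × X) X) (phi' : Hom (T × Y) Y) (p : Hom X Y) : Prop :=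
  p ∘ phi = phi' ∘ (idm T ⊗ p).

Lemma flow_morphism_id (C : CartesianCategory) (T : MonoidObject C) (X : C)
  (phi : Hom (T × X) X) : is_flow_morphism phi phi (idm X).
Proof.
unfold is_flow_morphism, prod_mor.
rewrite !comp_idl.
rewrite <- (comp_idr (pi1 T X)), <- (comp_idr (pi2 T X)), <- pair_uniq, comp_idr.
reflexivity.
Qed.

Lemma flow_morphism_comp (C : CartesianCategory) (T : MonoidObject C) (X Y Z : C)
  (phi : Hom (T × X) X) (phi' : Hom (T × Y) Y) (phi'' : Hom (T × Z) Z)
  (q : Hom Y Z) (p : Hom X Y) :
  is_flow_morphism phi' phi'' q -> is_flow_morphism phi phi' p ->
  is_flow_morphism phi phi'' (q ∘ p).
Proof.
unfold is_flow_morphism, prod_mor; intros Hq Hp.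
rewrite <- comp_assoc, Hp, comp_assoc, Hq, <- comp_assoc; f_equal.
rewrite (pair_uniq (⟨ _ , _ ⟩ ∘ _)), !comp_assoc, pi1_pair, pi2_pair.
rewrite <- !comp_assoc, pi1_pair, pi2_pair, !comp_idl; reflexivity.
Qed.

Definition TFlow (C : CartesianCategory) (T : MonoidObject C) : Category.
Proof.
refine {| Ob := Flow T;
          Hom := fun P P' => {p : Hom P P' | is_flow_morphism (flact P) (flact P') p};
          idm := fun P => exist _ (idm (flcar P)) (flow_morphism_id (flact P));
          comp := fun P P' P'' q p =>
            exist _ (proj1_sig q ∘ proj1_sig p)
              (flow_morphism_comp (proj2_sig q) (proj2_sig p)) |}.
- intros; apply sig_ext; apply comp_idl.
- intros; apply sig_ext; apply comp_idr.
- intros; apply sig_ext; apply comp_assoc.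
Defined.

Record ClockedSetting (C : CartesianCategory) (F : Functor C C) := {
  time : MonoidObject C;
  clock : Hom time (F time);
  psi : forall A B : C, Hom (F A × F B) (F (A × B));
  psi_natural : forall (A A' B B' : C) (f : Hom A A') (g : Hom B B'),
    fmap F (f ⊗ g) ∘ psi A B = psi A' B' ∘ (fmap F f ⊗ fmap F g);
  psi_assoc : forall X Y Z : C,
    fmap F (prod_assoc X Y Z) ∘ psi (X × Y) Z ∘ (psi X Y ⊗ idm (F Z)) =
    psi X (Y × Z) ∘ (idm (F X) ⊗ psi Y Z) ∘ prod_assoc (F X) (F Y) (F Z);
  stat : forall A : C, Hom A (F A);
  stat_natural : forall (A B : C) (f : Hom A B), fmap F f ∘ stat A = stat B ∘ f;
  psi_stat : forall A B : C, psi A B ∘ (stat A ⊗ stat B) = stat (A × B)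
}.
Arguments psi {C F} c A B.
Arguments stat {C F} c A.

Definition clock_sys (C : CartesianCategory) (F : Functor C C)
  (M : ClockedSetting F) : System F :=
  {| scar := time M; sstr := clock M |}.

Definition Lsys (C : CartesianCategory) (F : Functor C C)
  (M : ClockedSetting F) (X : C) : System F :=
  {| scar := time M × X; sstr := psi M (time M) X ∘ (clock M ⊗ stat M X) |}.

(* The stable system on [val] is [stat _ val]. *)
Record StabilitySetting (C : CartesianCategory) (F : Functor C C) := {
  clocked :> ClockedSetting F;
  space : C;
  val : C;
  val_pos : Posetal val;
  val_pt : Hom one val;
  dist : Hom (space × space) val;
  dist_ge : ple val_pos (val_pt ∘ bang (space × space)) dist;
  dist_eq : is_equalizer (diag space) dist (val_pt ∘ bang (space × space));
  Fval_pos : Posetal (F val);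
  comparison : forall gamma : Hom (time clocked) val,
    ple Fval_pos (fmap F gamma ∘ clock clocked) (stat clocked val ∘ gamma) ->
    ple val_pos gamma (gamma ∘ munit (time clocked) ∘ bang (time clocked));
  comparison_param : forall (A : C) (gamma : Hom (time clocked × A) val),
    ple Fval_pos (fmap F gamma ∘ sstr (Lsys clocked A)) (stat clocked val ∘ gamma) ->
    ple val_pos gamma
      (gamma ∘ at_zero (time clocked) A ∘ pi2 (time clocked) A)
}.

Definition T_complete (C : CartesianCategory) (F : Functor C C)
  (M : ClockedSetting F) (S : Sys F) : Prop :=
  forall (B : C) (g : Hom B (scar S)),
    exists! gamma : Hom (time M × B) (scar S),
      is_system_morphism (S := Lsys M B) (S' := S) gamma /\
      gamma ∘ at_zero (time M) B = g.

Definition TSys (C : CartesianCategory) (F : Functor C C) (M : ClockedSetting F) :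
  Category :=
  full_subcategory (T_complete M).

Definition is_solution (C : CartesianCategory) (F : Functor C C)
  (M : ClockedSetting F) (S : System F) (A : C) (phi : Hom (time M × A) S) : Prop :=
  is_system_morphism (S := Lsys M A) (S' := S) phi.

Definition is_solution_flow (C : CartesianCategory) (F : Functor C C)
  (M : ClockedSetting F) (S : System F) (phi : Hom (time M × S) S) : Prop :=
  is_solution (M := M) phi /\ is_flow phi.

Definition derivative (C : CartesianCategory) (F : Functor C C)
  (M : ClockedSetting F) (X : C) (phi : Hom (time M × X) X) : Hom X (F X) :=
  fmap F phi ∘ sstr (Lsys M X) ∘ at_zero (time M) X.

Definition derivative_sys (C : CartesianCategory) (F : Functor C C)
  (M : ClockedSetting F) (P : TFlow (time M)) : Sys F :=
  {| scar := flcar P; sstr := derivative (flact P) |}.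

Definition integral (C : CartesianCategory) (F : Functor C C)
  (M : ClockedSetting F) (S : TSys M) :
  Hom (time M × scar (proj1_sig S)) (scar (proj1_sig S)) :=
  proj1_sig (constructive_indefinite_description _
    (proj2_sig S (scar (proj1_sig S)) (idm (scar (proj1_sig S))))).

(* The next two functors are the identity on underlying morphisms; that they
   land in the target category is passed as hypotheses. *)
Definition integral_functor (C : CartesianCategory) (F : Functor C C)
  (M : ClockedSetting F)
  (Hob : forall S : TSys M, is_flow (integral S))
  (Hmor : forall (S S' : TSys M) (p : Hom S S'),
    is_flow_morphism (integral S) (integral S') (proj1_sig p)) :
  Functor (TSys M) (TFlow (time M)).
Proof.
refine (Build_Functor
  (C := TSys M) (D := TFlow (time M))
  (fob := fun S => {| flcar := scar (proj1_sig S);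
                      flact := integral S;
                      flact_flow := Hob S |})
  (fmap := fun S S' p => exist _ (proj1_sig p) (Hmor S S' p)) _ _).
- intros; apply sig_ext; reflexivity.
- intros; apply sig_ext; reflexivity.
Defined.

Definition derivative_functor (C : CartesianCategory) (F : Functor C C)
  (M : ClockedSetting F)
  (Hob : forall P : TFlow (time M), T_complete M (derivative_sys P))
  (Hmor : forall (P P' : TFlow (time M)) (p : Hom P P'),
    is_system_morphism (S := derivative_sys P) (S' := derivative_sys P')
      (proj1_sig p)) :
  Functor (TFlow (time M)) (TSys M).
Proof.
refine (Build_Functor
  (C := TFlow (time M)) (D := TSys M)
  (fob := fun P => exist _ (derivative_sys P) (Hob P))
  (fmap := fun P P' p => exist _ (proj1_sig p) (Hmor P P' p)) _ _).
- intros; apply sig_ext; reflexivity.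
- intros; apply sig_ext; reflexivity.
Defined.

(* Main.v *)
(* Every equation of maps into a T-complete system is proved by checking that
   both sides are morphisms out of some [Lsys M B] that agree at time zero.  For
   the action law of the integral, [B] is [T × X], and the two competitors are
   [phi ∘ (id ⊗ phi)] and [phi ∘ shift], where [shift (s, (t, x)) = (s + t, x)]
   is a morphism of systems [Lsys M (T × X) -> Lsys M X] because the
   multiplication is one and [psi] is associative.  The same morphism shows that
   a flow solves its own derivative, since [shift] is the identity at time
   zero. *)
From Stdlib Require Import Classical ClassicalEpsilon FunctionalExtensionality.
Require Import Defs.

Set Implicit Arguments.
Unset Strict Implicit.
Unset Printing Implicit Defensive.

Local Open Scope cat_scope.

(** * Identities of finite products *)

Lemma pair_ext (C : CartesianCategory) (X A B : C) (f g : Hom X (A × B)) :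
  pi1 A B ∘ f = pi1 A B ∘ g -> pi2 A B ∘ f = pi2 A B ∘ g -> f = g.
Proof.
intros H1 H2; rewrite (pair_uniq f), (pair_uniq g), H1, H2; reflexivity.
Qed.

Lemma pair_comp (C : CartesianCategory) (X Y A B : C)
  (f : Hom X A) (g : Hom X B) (h : Hom Y X) :
  ⟨ f , g ⟩ ∘ h = ⟨ f ∘ h , g ∘ h ⟩.
Proof.
apply pair_ext; rewrite comp_assoc.
- rewrite !pi1_pair; reflexivity.
- rewrite !pi2_pair; reflexivity.
Qed.

Lemma bang_comp (C : CartesianCategory) (A B : C) (f : Hom A B) :
  bang B ∘ f = bang A.
Proof. apply bang_uniq. Qed.

Lemma pair_pi (C : CartesianCategory) (A B : C) :
  ⟨ pi1 A B , pi2 A B ⟩ = idm (A × B).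
Proof. rewrite (pair_uniq (idm _)), !comp_idr; reflexivity. Qed.

Ltac cart :=
  unfold at_zero, prod_mor, prod_assoc;
  repeat progress (rewrite <- ?comp_assoc, ?pair_comp, ?pi1_pair, ?pi2_pair,
    ?comp_idl, ?comp_idr, ?bang_comp, ?pair_pi).

Lemma prod_mor_comp (C : CartesianCategory) (A A' A'' B B' B'' : C)
  (f' : Hom A' A'') (f : Hom A A') (g' : Hom B' B'') (g : Hom B B') :
  (f' ⊗ g') ∘ (f ⊗ g) = (f' ∘ f) ⊗ (g' ∘ g).
Proof. cart; reflexivity. Qed.

Lemma prod_assoc_natural (C : CartesianCategory) (A A' B B' D D' : C)
  (f : Hom A A') (g : Hom B B') (h : Hom D D') :
  prod_assoc A' B' D' ∘ (f ⊗ g ⊗ h) = (f ⊗ (g ⊗ h)) ∘ prod_assoc A B D.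
Proof. cart; reflexivity. Qed.

Definition prod_assoc_inv (C : CartesianCategory) (A B D : C) :
  Hom (A × (B × D)) ((A × B) × D) :=
  ⟨ ⟨ pi1 A (B × D) , pi1 B D ∘ pi2 A (B × D) ⟩ , pi2 B D ∘ pi2 A (B × D) ⟩.

Lemma prod_assocK (C : CartesianCategory) (A B D : C) :
  prod_assoc_inv A B D ∘ prod_assoc A B D = idm ((A × B) × D).
Proof.
unfold prod_assoc_inv; cart; rewrite <- pair_comp, pair_pi, comp_idl, pair_pi.
reflexivity.
Qed.

Lemma prod_assoc_invK (C : CartesianCategory) (A B D : C) :
  prod_assoc A B D ∘ prod_assoc_inv A B D = idm (A × (B × D)).
Proof.
unfold prod_assoc_inv; cart; rewrite <- pair_comp, pair_pi, comp_idl, pair_pi.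
reflexivity.
Qed.

(** * Time zero and the shift of time *)

Lemma at_zero_natural (C : CartesianCategory) (T : MonoidObject C) (A B : C)
  (p : Hom A B) :
  (idm T ⊗ p) ∘ at_zero T A = at_zero T B ∘ p.
Proof. cart; reflexivity. Qed.

Definition shift (C : CartesianCategory) (T : MonoidObject C) (X : C) :
  Hom (T × (T × X)) (T × X) :=
  (mmul T ⊗ idm X) ∘ prod_assoc_inv T T X.

Lemma shift_at_zero (C : CartesianCategory) (T : MonoidObject C) (X : C) :
  shift T X ∘ at_zero T (T × X) = idm (T × X).
Proof.
assert (E : mmul T ∘ ⟨ munit T ∘ bang (T × X) , pi1 T X ⟩ = pi1 T X).
{ transitivity (mmul T ∘ ⟨ munit T ∘ bang T , idm T ⟩ ∘ pi1 T X).
  - cart; reflexivity.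
  - rewrite mul_unitl, comp_idl; reflexivity. }
unfold shift, prod_assoc_inv; cart; rewrite E, pair_pi; reflexivity.
Qed.

(** Composition with the associativity isomorphism or its inverse passes between the two. The second
    form has source [T × (T × X)], the carrier of an [Lsys], where T-completeness can compare both
    sides. *)
Lemma flow_shift (C : CartesianCategory) (T : MonoidObject C) (X : C)
  (phi : Hom (T × X) X) :
  phi ∘ (mmul T ⊗ idm X) = phi ∘ (idm T ⊗ phi) ∘ prod_assoc T T X <->
  phi ∘ shift T X = phi ∘ (idm T ⊗ phi).
Proof.
unfold shift; split; intros E.
- rewrite comp_assoc, E, <- comp_assoc, prod_assoc_invK, comp_idr; reflexivity.
- rewrite <- E, <- !comp_assoc, prod_assocK, comp_idr; reflexivity.
Qed.

(** * Morphisms between the systems [Lsys] *)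

(* [sstr (Lsys M X)] with its source stated as a product, so that the
   cartesian identities apply without unfolding [Lsys]. *)
Definition Lmor (C : CartesianCategory) (F : Functor C C)
  (M : ClockedSetting F) (X : C) : Hom (time M × X) (F (time M × X)) :=
  psi M (time M) X ∘ (clock M ⊗ stat M X).

Lemma derivativeE (C : CartesianCategory) (F : Functor C C)
  (M : ClockedSetting F) (X : C) (phi : Hom (time M × X) X) :
  derivative phi = fmap F phi ∘ Lmor M X ∘ at_zero (time M) X.
Proof. reflexivity. Qed.

Lemma Lmor_natural (C : CartesianCategory) (F : Functor C C)
  (M : ClockedSetting F) (A B : C) (p : Hom A B) :
  fmap F (idm (time M) ⊗ p) ∘ Lmor M A = Lmor M B ∘ (idm (time M) ⊗ p).
Proof.
unfold Lmor.
rewrite comp_assoc, psi_natural, <- !comp_assoc, !prod_mor_comp.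
rewrite stat_natural, fmap_id, comp_idl, comp_idr; reflexivity.
Qed.

(** After reassociation the shift acts as [mmul] on the two times and as the identity on [X].
    Naturality of [psi] separates the factors, and [Hmul] settles the first. *)
Lemma Lmor_shift (C : CartesianCategory) (F : Functor C C)
  (M : ClockedSetting F)
  (Hmul : is_system_morphism (S := Lsys M (time M)) (S' := clock_sys M)
            (mmul (time M))) (X : C) :
  fmap F (shift (time M) X) ∘ Lmor M (time M × X) =
  Lmor M X ∘ shift (time M) X.
Proof.
assert (Hmul' : fmap F (mmul (time M)) ∘ Lmor M (time M) =
  clock M ∘ mmul (time M)) by exact Hmul.
(* Up to reassociation, [Lsys M (T × X)] is the product of [Lsys M T] and the
   stationary system on [X]. *)
assert (EL : Lmor M (time M × X) =
  fmap F (prod_assoc (time M) (time M) X) ∘ psi M (time M × time M) X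
    ∘ (Lmor M (time M) ⊗ stat M X) ∘ prod_assoc_inv (time M) (time M) X).
(* The inserted identity splits [Lmor M (time M) ⊗ stat M X] so that [psi ⊗ idm] appears and
   [psi_assoc] applies. At the end [psi_stat] merges the two stationary factors. *)
{ unfold Lmor; rewrite <- (comp_idl (stat M X)).
  rewrite <- prod_mor_comp, comp_assoc, psi_assoc.
  rewrite <- (comp_assoc _ (prod_assoc _ _ _)), prod_assoc_natural.
  rewrite <- !comp_assoc, prod_assoc_invK, comp_idr.
  rewrite prod_mor_comp, psi_stat, comp_idl; reflexivity. }
unfold shift; rewrite EL, !comp_assoc, <- fmap_comp.
rewrite <- (comp_assoc _ _ (prod_assoc (time M) (time M) X)).
rewrite prod_assocK, comp_idr, psi_natural; f_equal.
(* Only [Lmor M X] is opened; [Lmor M (time M)] stays folded for [Hmul']. *)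
unfold Lmor at 2; rewrite <- !comp_assoc, !prod_mor_comp.
rewrite Hmul', fmap_id, comp_idl, comp_idr; reflexivity.
Qed.

(** * Solutions and the integral *)

Lemma solution_comp (C : CartesianCategory) (F : Functor C C)
  (M : ClockedSetting F) (S : System F) (A B : C)
  (phi : Hom (time M × A) S) (q : Hom (time M × B) (time M × A)) :
  is_solution (M := M) phi -> fmap F q ∘ Lmor M B = Lmor M A ∘ q ->
  is_solution (M := M) (phi ∘ q).
Proof.
intros Hphi Hq.
exact (system_morphism_comp (S := Lsys M B) (S' := Lsys M A) Hphi Hq).
Qed.

(** Each side equals the unique solution that starts from their common value at time zero. *)
Lemma T_complete_ext (C : CartesianCategory) (F : Functor C C)
  (M : ClockedSetting F) (S : System F) (B : C) (u v : Hom (time M × B) S) :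
  T_complete M S -> is_solution (M := M) u -> is_solution (M := M) v ->
  u ∘ at_zero (time M) B = v ∘ at_zero (time M) B -> u = v.
Proof.
intros HS Hu Hv E.
destruct (HS B (v ∘ at_zero (time M) B)) as [w [_ Hw]].
transitivity w; [symmetry|]; apply Hw; split; auto.
Qed.

Lemma integral_solution (C : CartesianCategory) (F : Functor C C)
  (M : ClockedSetting F) (S : TSys M) :
  is_solution (M := M) (S := proj1_sig S) (integral S).
Proof.
unfold integral; destruct (constructive_indefinite_description _ _) as [g Hg].
apply Hg.
Qed.

Lemma integral_at_zero (C : CartesianCategory) (F : Functor C C)
  (M : ClockedSetting F) (S : TSys M) :
  integral S ∘ at_zero (time M) _ = idm (scar (proj1_sig S)).
Proof.
unfold integral; destruct (constructive_indefinite_description _ _) as [g Hg].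
apply Hg.
Qed.

Lemma integral_unique (C : CartesianCategory) (F : Functor C C)
  (M : ClockedSetting F) (S : TSys M)
  (phi : Hom (time M × scar (proj1_sig S)) (scar (proj1_sig S))) :
  is_solution (M := M) (S := proj1_sig S) phi ->
  phi ∘ at_zero (time M) _ = idm _ -> phi = integral S.
Proof.
intros Hphi E; apply (T_complete_ext (proj2_sig S)); auto.
- apply integral_solution.
- rewrite integral_at_zero; exact E.
Qed.

Lemma integral_flow (C : CartesianCategory) (F : Functor C C)
  (M : ClockedSetting F)
  (Hmul : is_system_morphism (S := Lsys M (time M)) (S' := clock_sys M)
            (mmul (time M))) (S : TSys M) :
  is_flow (integral S).
Proof.
split; [apply integral_at_zero|].
apply flow_shift, (T_complete_ext (proj2_sig S)).
- exact (solution_comp (integral_solution S) (Lmor_shift Hmul _)).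
- exact (solution_comp (integral_solution S) (Lmor_natural _ _)).
- rewrite <- !comp_assoc, shift_at_zero, at_zero_natural, comp_assoc.
  rewrite integral_at_zero, comp_idl, comp_idr; reflexivity.
Qed.

(** Both composites are solutions of [S'] with initial value [p]. *)
Lemma integral_morphism (C : CartesianCategory) (F : Functor C C)
  (M : ClockedSetting F) (S S' : TSys M) (p : Hom S S') :
  is_flow_morphism (integral S) (integral S') (proj1_sig p).
Proof.
apply (T_complete_ext (proj2_sig S')).
- exact (system_morphism_comp (proj2_sig p) (integral_solution S)).
- exact (solution_comp (integral_solution S') (Lmor_natural _ _)).
- rewrite <- !comp_assoc, at_zero_natural, integral_at_zero.
  rewrite (comp_assoc (integral S')), integral_at_zero, comp_idl, comp_idr.
  reflexivity.
Qed.

(** * The derivative of a flow *)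

Lemma derivative_solution (C : CartesianCategory) (F : Functor C C)
  (M : ClockedSetting F) (S : System F) (phi : Hom (time M × S) S) :
  is_solution (M := M) phi -> phi ∘ at_zero (time M) S = idm S ->
  derivative phi = sstr S.
Proof.
intros Hphi E; rewrite derivativeE.
rewrite (Hphi : fmap F phi ∘ Lmor M S = sstr S ∘ phi).
rewrite <- comp_assoc, E, comp_idr; reflexivity.
Qed.

Lemma derivative_morphism (C : CartesianCategory) (F : Functor C C)
  (M : ClockedSetting F) (P P' : TFlow (time M)) (p : Hom P P') :
  is_system_morphism (S := derivative_sys P) (S' := derivative_sys P')
    (proj1_sig p).
Proof.
destruct p as [p Hp]; unfold is_flow_morphism in Hp.
unfold is_system_morphism, derivative_sys; cbn [scar sstr proj1_sig].
rewrite !derivativeE, !comp_assoc, <- fmap_comp, Hp, fmap_comp.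
rewrite <- (comp_assoc _ (fmap F (idm _ ⊗ p))), Lmor_natural.
rewrite <- !comp_assoc, at_zero_natural; reflexivity.
Qed.

(** The derivative at [phi (t, x)] is the velocity at [s = 0] of [phi (s, phi (t, x))]. By the
    action law this is [phi (s + t, x)], and [Lmor_shift] turns its velocity at [s = 0] into that of
    [phi] at [(t, x)]. *)
Lemma flow_solves_derivative (C : CartesianCategory) (F : Functor C C)
  (M : ClockedSetting F)
  (Hmul : is_system_morphism (S := Lsys M (time M)) (S' := clock_sys M)
            (mmul (time M))) (P : TFlow (time M)) :
  is_solution (M := M) (S := derivative_sys P) (flact P).
Proof.
destruct P as [X phi [H0 Hact]].
pose proof (proj1 (flow_shift phi) Hact) as Hshift.
change (fmap F phi ∘ Lmor M X = derivative phi ∘ phi).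
rewrite derivativeE, <- comp_assoc, <- at_zero_natural, comp_assoc.
rewrite <- (comp_assoc _ (Lmor M X)), <- Lmor_natural.
rewrite !comp_assoc, <- fmap_comp, <- Hshift, fmap_comp.
rewrite <- (comp_assoc _ (fmap F (shift _ _))), Lmor_shift by exact Hmul.
rewrite <- !comp_assoc, shift_at_zero, comp_idr; reflexivity.
Qed.

(** * Strict equality of functors *)

Definition hom_cast (C : Category) (A A' B B' : C) (eA : A = A') (eB : B = B')
  (f : Hom A B) : Hom A' B' :=
  match eA in _ = A1, eB in _ = B1 return Hom A1 B1 with
  | eq_refl, eq_refl => f
  end.

(** The values on an arrow have endpoints that are only provably equal, hence the cast. Once the
    object maps are identified, proof irrelevance makes each [e A] reflexivity and the cast
    disappears. *)
Lemma functor_ext (C D : Category) (F G : Functor C D) (e : forall A, F A = G A) :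
  (forall (A B : C) (f : Hom A B), hom_cast (e A) (e B) (fmap F f) = fmap G f) ->
  F = G.
Proof.
destruct F as [fo fm fi fc], G as [go gm gi gc]; simpl in *; intros H.
assert (E : fo = go) by (apply functional_extensionality, e).
subst go.
assert (Em : fm = gm).
{ apply functional_extensionality_dep; intros A.
  apply functional_extensionality_dep; intros B.
  apply functional_extensionality; intros f.
  rewrite <- H, (proof_irrelevance _ (e A) eq_refl),
    (proof_irrelevance _ (e B) eq_refl); reflexivity. }
subst gm.
rewrite (proof_irrelevance _ fi gi), (proof_irrelevance _ fc gc); reflexivity.
Qed.

(** The carriers [X] and [Y] are fixed, so the cast changes only structure maps and completeness
    proofs, never the arrow of [C]. *)
Lemma TSys_hom_cast (C : CartesianCategory) (F : Functor C C)
  (M : ClockedSetting F) (X Y : C) (s s' : Hom X (F X)) (t t' : Hom Y (F Y))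
  (hs : T_complete M {| sstr := s |}) (hs' : T_complete M {| sstr := s' |})
  (ht : T_complete M {| sstr := t |}) (ht' : T_complete M {| sstr := t' |})
  (e1 : exist (T_complete M) _ hs = exist (T_complete M) _ hs')
  (e2 : exist (T_complete M) _ ht = exist (T_complete M) _ ht')
  (p : Hom (c := TSys M) (exist _ _ hs) (exist _ _ ht)) :
  s = s' -> t = t' ->
  proj1_sig (hom_cast (C := TSys M) e1 e2 p) = proj1_sig p.
Proof.
intros Es Et; subst s' t'.
destruct (proof_irrelevance _ hs hs'), (proof_irrelevance _ ht ht').
rewrite (proof_irrelevance _ e1 eq_refl), (proof_irrelevance _ e2 eq_refl).
reflexivity.
Qed.

Lemma TFlow_hom_cast (C : CartesianCategory) (T : MonoidObject C) (X Y : C)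
  (a a' : Hom (T × X) X) (b b' : Hom (T × Y) Y)
  (ha : is_flow a) (ha' : is_flow a') (hb : is_flow b) (hb' : is_flow b')
  (e1 : {| flact_flow := ha |} = {| flact_flow := ha' |})
  (e2 : {| flact_flow := hb |} = {| flact_flow := hb' |})
  (p : Hom (c := TFlow T) {| flact_flow := ha |} {| flact_flow := hb |}) :
  a = a' -> b = b' ->
  proj1_sig (hom_cast (C := TFlow T) e1 e2 p) = proj1_sig p.
Proof.
intros Ea Eb; subst a' b'.
destruct (proof_irrelevance _ ha ha'), (proof_irrelevance _ hb hb').
rewrite (proof_irrelevance _ e1 eq_refl), (proof_irrelevance _ e2 eq_refl).
reflexivity.
Qed.

(** Both composites preserve carriers and underlying arrows, so only structure maps and actions need
    comparing, which the two final hypotheses do. *)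
Lemma integral_derivative_inverse (C : CartesianCategory) (F : Functor C C)
  (M : ClockedSetting F)
  (Iob : forall S : TSys M, is_flow (integral S))
  (Imor : forall (S S' : TSys M) (p : Hom S S'),
     is_flow_morphism (integral S) (integral S') (proj1_sig p))
  (Dob : forall P : TFlow (time M), T_complete M (derivative_sys P))
  (Dmor : forall (P P' : TFlow (time M)) (p : Hom P P'),
     is_system_morphism (S := derivative_sys P) (S' := derivative_sys P')
       (proj1_sig p)) :
  let Int := integral_functor Iob Imor in
  let D := derivative_functor Dob Dmor in
  (forall P : TFlow (time M), flact P = integral (D P)) ->
  (forall S : TSys M, sstr (proj1_sig S) = derivative (integral S)) ->
  inverse_functors Int D.
Proof.
intros Int D HID HDI; split.
- assert (e : forall S : TSys M, functor_comp D Int S = functor_id (TSys M) S).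
  { intros [[X s] h]; apply sig_ext; symmetry.
    exact (f_equal (fun d => {| sstr := d |}) (HDI (exist _ _ h))). }
  apply (functor_ext (e := e)).
  intros [[X s] hs] [[Y t] ht] p; apply sig_ext.
  exact (TSys_hom_cast (e (exist _ _ hs)) (e (exist _ _ ht))
    (fmap (functor_comp D Int) p)
    (eq_sym (HDI (exist _ _ hs))) (eq_sym (HDI (exist _ _ ht)))).
- assert (e : forall P : TFlow (time M),
    functor_comp Int D P = functor_id (TFlow (time M)) P).
  { intros [X a ha].
    (* The match replaces the action while the proof of its laws is generalised to [hb], which proof
       irrelevance then identifies with [ha]. *)
    refine (match HID {| flact_flow := ha |} in _ = b return
      forall hb : is_flow b, {| flact_flow := hb |} = {| flact_flow := ha |}
      with eq_refl => fun hb => _ end _).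
    rewrite (proof_irrelevance _ hb ha); reflexivity. }
  apply (functor_ext (e := e)).
  intros [X a ha] [Y b hb] p; apply sig_ext.
  exact (TFlow_hom_cast (e {| flact_flow := ha |}) (e {| flact_flow := hb |})
    (fmap (functor_comp Int D) p)
    (eq_sym (HID {| flact_flow := ha |})) (eq_sym (HID {| flact_flow := hb |}))).
Qed.

Theorem theorem6p4 (C : CartesianCategory) (F : Functor C C)
  (M : StabilitySetting F)
  (HT : T_complete M (clock_sys M))
  (Hmul : is_system_morphism (S := Lsys M (time M)) (S' := clock_sys M)
            (mmul (time M))) :
  (forall S : TSys M,
     is_solution (M := M) (S := proj1_sig S) (integral S)) /\
  exists (Iob : forall S : TSys M, is_flow (integral S))
         (Imor : forall (S S' : TSys M) (p : Hom S S'),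
            is_flow_morphism (integral S) (integral S') (proj1_sig p)),
  let Int : Functor (TSys M) (TFlow (time M)) := integral_functor Iob Imor in
  forall Dob : forall P : TFlow (time M), T_complete M (derivative_sys P),
    (forall (S : System F) (phi : Hom (time M × S) S),
       is_solution_flow (M := M) phi ->
       exists HS : T_complete M S, phi = integral (exist (T_complete M) S HS)) /\
    exists Dmor : forall (P P' : TFlow (time M)) (p : Hom P P'),
      is_system_morphism (S := derivative_sys P) (S' := derivative_sys P')
        (proj1_sig p),
    let D : Functor (TFlow (time M)) (TSys M) := derivative_functor Dob Dmor in
    (forall P : TFlow (time M), flact P = integral (D P)) /\
    (forall S : TSys M, sstr (proj1_sig S) = derivative (flact (Int S))) /\
    inverse_functors Int D.
Proof.
split; [intros S; apply integral_solution|].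
exists (integral_flow Hmul), (@integral_morphism _ _ M).
intros Int Dob; split.
- intros S phi [Hsol Hfl].
  (* Completeness of [S] comes from [Dob]: the derivative of the solution flow [phi] is [sstr S]
     itself. *)
  assert (HS : T_complete M S).
  { generalize (Dob {| flact_flow := Hfl |}); unfold derivative_sys; simpl.
    rewrite (derivative_solution Hsol (proj1 Hfl)); destruct S; auto. }
  exists HS; exact (integral_unique (S := exist _ S HS) Hsol (proj1 Hfl)).
- exists (@derivative_morphism _ _ M); intros D.
  assert (HID : forall P : TFlow (time M), flact P = integral (D P)).
  { intros P; apply (integral_unique (S := D P)).
    - exact (flow_solves_derivative Hmul P).
    - apply (flact_flow P). }
  assert (HDI : forall S : TSys M,
    sstr (proj1_sig S) = derivative (integral S)).
  { intros S; symmetry; apply derivative_solution.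
    - apply integral_solution.
    - apply integral_at_zero. }
  split; [exact HID | split; [exact HDI|]].
  exact (@integral_derivative_inverse _ _ _ _ _ _ _ HID HDI).
Qed.
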